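(* Let $k$ be an algebraically closed field, let $A$ be a basic finite-dimensional self-injective $k$-algebra, and let $M$ be a right $A$-module with $\dim_k M = d$. Suppose that $\operatorname{cx}_A(M) = 1$ and that the $\mathrm{GL}_d(k)$-orbit $\mathcal{O}(M)$ of $M$ is Zariski open in $\mathrm{Mod}^A_d$. Then $M$ is periodic.
   Context: For a finitely generated $k$-algebra $A$, fix a presentation $A \cong k\langle x_1,\dots,x_s\rangle/(\rho_i)_{i\in I}$ (with $x_1 - 1$ among the relations). The module variety $\mathrm{Mod}^A_d$ is the affine variety of tuples $(X_1,\dots,X_s)$ of $d\times d$ matrices over $k$ with $X_1 = I$ satisfying all relations $\rho_i$; its points correspond to right $A$-module structures on $k^d$. The group $\mathrm{GL}_d(k)$ acts on it by simultaneous conjugation, and the orbits correspond bijectively to isomorphism classes of $d$-dimensional $A$-modules; $\mathcal{O}(M)$ denotes the orbit of (the point corresponding to) $M$. The complexity of $M$ is $\operatorname{cx}_A(M) = \inf\{n \ge 0 : \exists C>0,\ \dim_k P^t \le C t^{n-1}\ \forall t\ge 0\}$, where $P^\bullet$ is a minimal projective resolution of $M$. A module $M$ is periodic if it has a periodic projective resolution, equivalently (over a self-injective algebra, for $M$ without projective summands) $\Omega^n M \cong M$ for some $n \ge 1$, where $\Omega$ is the syzygy functor. *)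

(* Defs.v *)
From HB Require Import structures.
From mathcomp Require Import all_boot all_order all_algebra all_field.
Set Implicit Arguments. Unset Strict Implicit. Unset Printing Implicit Defensive.
Import Order.TTheory GRing.Theory Num.Theory.
Local Open Scope ring_scope.

Section Modules.
Variables (k : fieldType) (A : falgType k).

(* A d-dimensional right A-module structure on row vectors k^d:
   v . a := v *m rho a.  Right action: rho (a * b) = rho a *m rho b. *)
Definition is_rep (d : nat) (rho : A -> 'M[k]_d) : Prop :=
  [/\ forall (c : k) (a b : A), rho (c *: a + b) = c *: rho a + rho b,
      rho 1 = 1%:M
    & forall a b : A, rho (a * b) = rho a *m rho b].

Record rmod := RMod { mdim : nat; mact : A -> 'M[k]_mdim }.

Definition is_mod (M : rmod) : Prop := is_rep (mact M).

Definition hom (M N : rmod) (f : 'M[k]_(mdim M, mdim N)) : Prop :=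
  forall a : A, mact M a *m f = f *m mact N a.

Definition projective (P : rmod) : Prop :=
  forall (X Y : rmod) (g : 'M[k]_(mdim X, mdim Y)) (h : 'M[k]_(mdim P, mdim Y)),
    is_mod X -> is_mod Y -> hom g -> row_full g -> hom h ->
    exists l : 'M[k]_(mdim P, mdim X), hom l /\ l *m g = h.

Definition injective (I : rmod) : Prop :=
  forall (X Y : rmod) (g : 'M[k]_(mdim X, mdim Y)) (h : 'M[k]_(mdim X, mdim I)),
    is_mod X -> is_mod Y -> hom g -> row_free g -> hom h ->
    exists l : 'M[k]_(mdim Y, mdim I), hom l /\ g *m l = h.

Definition regmx (a : A) : 'M[k]_(\dim (fullv : {vspace A})) :=
  \matrix_(i, j) coord (vbasis fullv) j (tnth (vbasis fullv) i * a).

Definition regmod : rmod := @RMod (\dim (fullv : {vspace A})) regmx.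

Definition self_injective : Prop := injective regmod.

Definition simple_mod (S : rmod) : Prop :=
  (0 < mdim S)%N /\
  forall (N : rmod) (f : 'M[k]_(mdim N, mdim S)),
    is_mod N -> hom f -> row_free f -> mdim N = 0%N \/ mdim N = mdim S.

(* basic (over an algebraically closed field): every simple module is
   one-dimensional, i.e. A / rad A is a product of copies of k. *)
Definition basic : Prop :=
  forall S : rmod, is_mod S -> simple_mod S -> mdim S = 1%N.

(* f : P -> X (with P projective) is a projective cover onto its image:
   its kernel is superfluous in P. *)
Definition is_cover (P : rmod) (X : nat) (f : 'M[k]_(mdim P, X)) : Prop :=
  forall (N : rmod) (g : 'M[k]_(mdim N, mdim P)),
    is_mod N -> hom g -> (g *m f == f)%MS -> row_full g.

Definition proj_res (M : rmod) (P : nat -> rmod)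
    (d : forall t, 'M[k]_(mdim (P t.+1), mdim (P t)))
    (e : 'M[k]_(mdim (P 0%N), mdim M)) : Prop :=
  (forall t, is_mod (P t)) /\
  (forall t, projective (P t)) /\
  (hom e /\ row_full e) /\
  (forall t, hom (d t)) /\
  (d 0%N == kermx e)%MS /\
  (forall t, (d t.+1 == kermx (d t))%MS).

Definition min_proj_res (M : rmod) (P : nat -> rmod)
    (d : forall t, 'M[k]_(mdim (P t.+1), mdim (P t)))
    (e : 'M[k]_(mdim (P 0%N), mdim M)) : Prop :=
  proj_res d e /\ is_cover e /\ forall t, is_cover (d t).

Definition growth (n : nat) (dims : nat -> nat) : Prop :=
  exists C : rat, 0 < C /\
    forall t : nat, (0 < t)%N -> (dims t)%:R <= C * ((t%:R : rat) ^ (n%:Z - 1)).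

Definition complexity (M : rmod) (n : nat) : Prop :=
  exists (P : nat -> rmod) (d : forall t, 'M[k]_(mdim (P t.+1), mdim (P t)))
         (e : 'M[k]_(mdim (P 0%N), mdim M)),
    min_proj_res d e /\ growth n (fun t => mdim (P t)) /\
    forall m, (m < n)%N -> ~ growth m (fun t => mdim (P t)).

Definition mxnat (m n : nat) (B : 'M[k]_(m, n)) (i j : nat) : k :=
  match (insub i : option 'I_m), (insub j : option 'I_n) with
  | Some i', Some j' => B i' j'
  | _, _ => 0
  end.

Definition periodic (M : rmod) : Prop :=
  exists (P : nat -> rmod) (d : forall t, 'M[k]_(mdim (P t.+1), mdim (P t)))
         (e : 'M[k]_(mdim (P 0%N), mdim M)),
    proj_res d e /\
    exists n : nat, (0 < n)%N /\
      forall t, P (t + n)%N = P t /\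
        forall i j : nat, mxnat (d (t + n)%N) i j = mxnat (d t) i j.

Inductive pexpr (V : Type) : Type :=
| PC of k | PX of V | PAdd of pexpr V & pexpr V | PMul of pexpr V & pexpr V.

Fixpoint peval (V : Type) (x : V -> k) (p : pexpr V) : k :=
  match p with
  | PC c => c
  | PX v => x v
  | PAdd p q => peval x p + peval x q
  | PMul p q => peval x p * peval x q
  end.

Definition mvvar (d : nat) := ('I_(\dim (fullv : {vspace A})) * 'I_d * 'I_d)%type.

Definition mvcoord (d : nat) (rho : A -> 'M[k]_d) (v : mvvar d) : k :=
  let: (i, r, c) := v in rho (tnth (vbasis fullv) i) r c.

Definition zariski_open (d : nat) (U : (A -> 'M[k]_d) -> Prop) : Prop :=
  exists F : pexpr (mvvar d) -> Prop,
    forall rho : A -> 'M[k]_d, is_rep rho ->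
      (U rho <-> exists p, F p /\ peval (mvcoord rho) p != 0).

Definition mod_orbit (M : rmod) : (A -> 'M[k]_(mdim M)) -> Prop :=
  fun rho => exists Q : 'M[k]_(mdim M), Q \in unitmx /\
     forall a, rho a = invmx Q *m mact M a *m Q.

End Modules.

Arguments mod_orbit [k A] M _.

(* Main.v *)
(** Let N_t be the t-th syzygy of M in a minimal projective resolution.  Call a module X
    stably open if all modules in a Zariski neighbourhood of X are stably isomorphic to X
    (isomorphic up to projective summands).  M is stably open by hypothesis, and stable
    openness passes from the right end of a short exact sequence 0 -> N -> P -> M -> 0 with
    P projective to its left end: P is also injective, so N -> P extends to an algebraic
    family of homomorphisms rho -> P defined for every point rho near N, whose cokernels
    form an algebraic family through M; they are stably isomorphic to M, hence by Schanuel's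
    lemma rho is stably isomorphic to N.  So every N_t is stably open.

    Complexity 1 bounds the dimensions of the N_t, so infinitely many of them lie in one
    module variety.  Its coordinate ring is noetherian, so some N_i in this list has a later
    N_j in its given neighbourhood; thus N_i and N_j are stably isomorphic, and, projectives
    being injective, so are M and N_(j-i).  Exchanging N_(j-i) for M at the end of the
    resolution closes it up to a periodic one. *)
From Pilot Require Import Defs.
From HB Require Import structures.
From mathcomp Require Import all_boot all_order all_algebra all_field.
From Stdlib Require Import Classical ClassicalEpsilon.
Import Pilot.Defs.

Set Implicit Arguments.
Unset Strict Implicit.
Unset Printing Implicit Defensive.
Import Order.TTheory GRing.Theory Num.Theory.

(** * Hilbert's basis theorem *)

Section Noetherian.
Local Open Scope ring_scope.

Definition in_span (R : comNzRingType) (g : nat -> R) (n : nat) (h : R) : Prop :=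
  exists c : nat -> R, h = \sum_(i < n) c i * g i.

(** A form of the ascending chain condition that avoids ideals: no sequence keeps leaving the ideal
    generated by its earlier terms. *)
Definition noetherian (R : comNzRingType) : Prop :=
  forall a : nat -> R, exists n, in_span a n (a n).

Section Span.
Variable R : comNzRingType.
Implicit Types (f g : nat -> R) (h : R).

Lemma span0 g n : in_span g n 0.
Proof. by exists (fun=> 0); rewrite big1 // => i _; rewrite mul0r. Qed.

Lemma spanD g n h h' : in_span g n h -> in_span g n h' -> in_span g n (h + h').
Proof.
move=> [c ->] [c' ->]; exists (fun i => c i + c' i).
by rewrite -big_split; apply: eq_bigr => i _; rewrite mulrDl.
Qed.

Lemma spanM g n r h : in_span g n h -> in_span g n (r * h).
Proof.
move=> [c ->]; exists (fun i => r * c i).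
by rewrite mulr_sumr; apply: eq_bigr => i _; rewrite mulrA.
Qed.

Lemma span_sum g n m (F : 'I_m -> R) :
  (forall i, in_span g n (F i)) -> in_span g n (\sum_i F i).
Proof.
move=> H; elim/big_rec: _ => [|i x _]; [exact: span0 | exact: spanD].
Qed.

Lemma span_gen g n i : (i < n)%N -> in_span g n (g i).
Proof.
move=> lin; exists (fun j => (j == i)%:R); rewrite (bigD1 (Ordinal lin)) //= eqxx mul1r.
by rewrite big1 ?addr0 // => j /negPf; rewrite -val_eqE /= => ->; rewrite mul0r.
Qed.

Lemma span_trans f g n m h :
  (forall i, (i < n)%N -> in_span f m (g i)) -> in_span g n h -> in_span f m h.
Proof. by move=> H [c ->]; apply: span_sum => i; apply: spanM; apply: H. Qed.

Lemma span_le g n m h : (n <= m)%N -> in_span g n h -> in_span g m h.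
Proof. by move=> le; apply: span_trans => i lti; apply: span_gen; exact: leq_trans le. Qed.

Lemma span_eq f g n h : (forall i, (i < n)%N -> f i = g i) -> in_span f n h -> in_span g n h.
Proof. by move=> H; apply: span_trans => i lti; rewrite H //; exact: span_gen. Qed.

End Span.

(** The classical argument by minimal degree: a counterexample [f] generates an ideal [I] that is
    not finitely generated. Choose [g n] of least size in [I] outside the span of its predecessors;
    a relation between leading coefficients then gives a smaller choice. *)
Theorem hilbert_basis (R : comNzRingType) : noetherian R -> noetherian {poly R}.
Proof.
move=> NR f; apply: NNPP => H.
have {}H n : ~ in_span f n (f n) by move=> Hn; apply: H; exists n.
pose I h := exists K, in_span f K h.
have ID h h' : I h -> I h' -> I (h + h').
  move=> [K s] [K' s']; exists (maxn K K').
  by apply: spanD; [apply: span_le s | apply: span_le s']; rewrite ?leq_maxl ?leq_maxr.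
have IM r h : I h -> I (r * h) by move=> [K s]; exists K; exact: spanM.
have I0 : I 0 by exists 0%N; exact: span0.
pose good (g : nat -> {poly R}) n h := [/\ I h, ~ in_span g n h &
  forall h', I h' -> ~ in_span g n h' -> (size h <= size h')%N].
have ex_good g n : (forall i, (i < n)%N -> I (g i)) -> exists h, good g n h.
  move=> Ig; have [K HK] : exists K, forall i, (i < n)%N -> in_span f K (g i).
    elim: n Ig => [|n IH] Ig; first by exists 0%N.
    have [K HK] := IH (fun i lt => Ig i (ltnW lt)); have [K' s'] := Ig n (leqnn _).
    exists (maxn K K') => i; rewrite ltnS leq_eqVlt => /orP[/eqP->|lt].
      by apply: span_le s'; rewrite leq_maxr.
    by apply: span_le (HK _ lt); rewrite leq_maxl.
  (* If [f K] were in the span of the [g i], it would be in the span of the first [K] terms of [f],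
     against [H]. A descent on the size then reaches a minimal element. *)
  have [h0 Ih0 nh0] : exists2 h, I h & ~ in_span g n h.
    exists (f K); first by exists K.+1; exact: span_gen.
    by move=> s; apply: (H K); exact: span_trans s.
  move: {2}(size h0) (leqnn (size h0)) => b.
  elim: b h0 Ih0 nh0 => [|b IH] h Ih nh le.
    by exists h; split=> // h' _ _; apply: leq_trans le _.
  case: (classic (exists2 h', I h' /\ ~ in_span g n h' & (size h' < size h)%N)).
    by move=> [h' [Ih' nh'] lt]; apply: (IH h') => //; rewrite -ltnS; exact: leq_trans le.
  move=> nex; exists h; split=> // h' Ih' nh'; rewrite leqNgt; apply/negP => lt.
  by apply: nex; exists h'.
(* Each choice depends on all earlier ones, so the recursion builds the list [G n] of the first [n]
   choices. *)
pose pick (s : seq {poly R}) : {poly R} :=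
  epsilon (inhabits 0) (good (nth 0 s) (size s)).
pose fix G n := if n is n'.+1 then rcons (G n') (pick (G n')) else [::].
pose g n := pick (G n).
have GE n : G n = mkseq g n by elim: n => //= n IH; rewrite mkseqS -IH.
have gP n : good g n (g n).
  elim/ltn_ind: n => n IH.
  have : exists h, good (nth 0 (G n)) (size (G n)) h.
    apply: ex_good => i; rewrite GE size_mkseq => lt; rewrite nth_mkseq //.
    by case: (IH i lt).
  move/(epsilon_spec (inhabits 0)); rewrite -/(pick (G n)) -/(g n) GE size_mkseq.
  case=> Ig ng ming; split=> //.
    by move=> s; apply: ng; apply: span_eq s => i lt; rewrite nth_mkseq.
  move=> h' Ih' nh'; apply: ming => // s; apply: nh'; apply: span_eq s => i lt.
  by rewrite nth_mkseq.
have g0 n : (0 < size (g n))%N.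
  rewrite size_poly_gt0; apply/eqP => e; case: (gP n) => _ + _; rewrite e; apply.
  exact: span0.
have gle i n : (i < n)%N -> (size (g i) <= size (g n))%N.
  move=> lt; case: (gP i) => _ _; apply; first by case: (gP n).
  by move=> s; case: (gP n) => _ + _; apply; apply: span_le s; exact: ltnW.
have [n [c an]] := NR (fun n => lead_coef (g n)).
have [In nn minn] := gP n.
(* The powers of ['X] raise every [g i] to the size of [g n], so that [S] cancels the leading term
   of [g n]. No subtraction is truncated, by [gle]. *)
pose S := \sum_(i < n) (c i)%:P * 'X^(size (g n) - size (g i)) * g i.
have sS : in_span g n S by apply: span_sum => i; apply: spanM; exact: span_gen.
have IS : I S.
  rewrite /S; elim/big_rec: _ => [//|i x _ Ix]; apply: ID => //; apply: IM.
  by case: (gP i).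
have lt : (size (g n - S)%R < size (g n))%N.
  rewrite -(prednK (g0 n)) ltnS; apply/leq_sizeP => j lej.
  rewrite coefB coef_sum.
  have T (i : 'I_n) : ((c i)%:P * 'X^(size (g n) - size (g i)) * g i)`_j =
      c i * (g i)`_(j - (size (g n) - size (g i))).
    rewrite -mulrA coefCM coefXnM ltnNge.
    have -> : (size (g n) - size (g i) <= j)%N; last by [].
    apply: leq_trans lej; rewrite -subn1 leq_sub2l //; exact: g0.
  rewrite (eq_bigr _ (fun i _ => T i)).
  move: lej; rewrite leq_eqVlt => /orP[/eqP <-|lej].
    rewrite -lead_coefE an; apply/eqP; rewrite subr_eq0; apply/eqP.
    apply: eq_bigr => i _; rewrite lead_coefE; congr (_ * (g i)`_ _).
    rewrite -subn1 -[in RHS]subn1 -subnDA addnC subnDA subKn //; exact: gle.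
  have lej' : (size (g n) <= j)%N by rewrite -(prednK (g0 n)).
  rewrite nth_default // big1 ?subr0 // => i _; rewrite nth_default ?mulr0 //.
  have le := gle i n (ltn_ord i).
  by rewrite leq_subRL ?subnK //; apply: leq_trans lej'; exact: leq_subr.
have := minn (g n - S) (ID _ _ In _) _; rewrite leqNgt lt; move=> F.
suff : false by []; apply: F.
  by rewrite -mulN1r; exact: IM.
move=> s; apply: nn; rewrite -(subrK S (g n)); exact: spanD.
Qed.

Lemma noetherian_field (k : fieldType) : noetherian k.
Proof.
move=> a; case: (eqVneq (a 0%N) 0) => [a0|a0].
  by exists 0%N; rewrite a0; exact: span0.
exists 1%N, (fun=> a 1%N / a 0%N); by rewrite big_ord1 divfK.
Qed.

(** [R] is an iterated polynomial ring with one variable for each entry of [L], and [phi t] is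
    evaluation at the point [t]. Thus polynomial functions on all points come from one noetherian
    ring. *)
Lemma noetherian_coordinates (k : fieldType) (Pt : Type) (V : eqType)
    (x : Pt -> V -> k) (L : seq V) :
  exists (R : comNzRingType) (phi : Pt -> {rmorphism R -> k}),
    [/\ noetherian R, forall c, exists r, forall t, phi t r = c &
        forall v, v \in L -> exists r, forall t, phi t r = x t v].
Proof.
elim: L => [|v L [R [phi [NR phiC phiL]]]].
  exists k, (fun=> idfun); split=> //; first exact: noetherian_field.
  by move=> c; exists c.
exists {poly R}, (fun t => (horner_eval (x t v) \o map_poly (phi t)) : {rmorphism _ -> _}).
have E t r : horner_eval (x t v) (map_poly (phi t) r%:P) = phi t r.
  by rewrite map_polyC /horner_eval hornerC.
split; first exact: hilbert_basis.
- by move=> c; have [r H] := phiC c; exists r%:P => t; rewrite /= E.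
- move=> w; rewrite inE => /orP[/eqP->|/phiL[r H]]; last by exists r%:P => t; rewrite /= E.
  by exists 'X => t; rewrite /= map_polyX /horner_eval hornerX.
Qed.

(** Some [u n] is a combination of earlier [u i]. If all of these vanished at [x n], then so would
    [u n]. *)
Lemma noetherian_points (k : fieldType) (V : finType) (x : nat -> V -> k)
    (u : nat -> pexpr k V) : (forall n, peval (x n) (u n) != 0) ->
  exists i j, (i < j)%N /\ peval (x j) (u i) != 0.
Proof.
move=> u0; have [R [phi [NR phiC phiV]]] := noetherian_coordinates x (enum V).
have E (p : pexpr k V) : exists r, forall t, phi t r = peval (x t) p.
  elim: p => [c|v|p [r Hr] q [s Hs]|p [r Hr] q [s Hs]] /=.
  - exact: phiC.
  - by apply: phiV; rewrite mem_enum.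
  - by exists (r + s) => t; rewrite rmorphD Hr Hs.
  - by exists (r * s) => t; rewrite rmorphM Hr Hs.
pose a n := epsilon (inhabits 0) (fun r => forall t, phi t r = peval (x t) (u n)).
have aE n t : phi t (a n) = peval (x t) (u n).
  exact: (epsilon_spec (inhabits 0) _ (E (u n))).
have [n [c ec]] := NR a.
apply: NNPP => H; have := u0 n; rewrite -aE ec rmorph_sum big1 ?eqxx // => i _.
rewrite rmorphM aE; case: (eqVneq (peval (x n) (u i)) 0) => [->|ne]; first by rewrite mulr0.
by case: H; exists (nat_of_ord i), n.
Qed.

End Noetherian.

(** * Short exact sequences and stable equivalence *)

Section ModuleAlgebra.
Local Open Scope ring_scope.
Variables (k : fieldType) (A : falgType k).
Implicit Types (X Y Z T P Q M N W : rmod A).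

Lemma hom1 X : hom (1%:M : 'M_(mdim X, mdim X)).
Proof. by move=> a; rewrite mul1mx mulmx1. Qed.

Lemma homM X Y Z (f : 'M_(mdim X, mdim Y)) (g : 'M_(mdim Y, mdim Z)) :
  hom f -> hom g -> hom (f *m g : 'M_(mdim X, mdim Z)).
Proof. by move=> hf hg a; rewrite mulmxA hf -!mulmxA hg. Qed.

Lemma homD X Y (f g : 'M_(mdim X, mdim Y)) :
  hom f -> hom g -> hom (f + g : 'M_(mdim X, mdim Y)).
Proof. by move=> hf hg a; rewrite mulmxDl mulmxDr hf hg. Qed.

Lemma homN X Y (f : 'M_(mdim X, mdim Y)) :
  hom f -> hom (- f : 'M_(mdim X, mdim Y)).
Proof. by move=> hf a; rewrite mulmxN mulNmx hf. Qed.

Lemma hom0 X Y : hom (0 : 'M_(mdim X, mdim Y)).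
Proof. by move=> a; rewrite mulmx0 mul0mx. Qed.

Lemma hom_cancelr X Y Z (f : 'M_(mdim X, mdim Y)) (g : 'M_(mdim Y, mdim Z)) :
  row_free g -> hom g -> hom (f *m g : 'M_(mdim X, mdim Z)) -> hom f.
Proof.
by move=> fg hg hfg a; apply: (row_free_inj fg); rewrite -!mulmxA hg !mulmxA -hfg !mulmxA.
Qed.

Lemma hom_cancell X Y Z (f : 'M_(mdim X, mdim Y)) (g : 'M_(mdim Y, mdim Z)) :
  row_full f -> hom f -> hom (f *m g : 'M_(mdim X, mdim Z)) -> hom g.
Proof.
by move=> ff hf hfg a; apply: (row_full_inj ff); rewrite !mulmxA -hf -!mulmxA hfg !mulmxA.
Qed.

Definition dsum X Y : rmod A :=
  @RMod k A (mdim X + mdim Y) (fun a => block_mx (mact X a) 0 0 (mact Y a)).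

Lemma dsum_mod X Y : is_mod X -> is_mod Y -> is_mod (dsum X Y).
Proof.
move=> [lX oX mX] [lY oY mY]; split=> [c a b||a b] /=.
- by rewrite lX lY scale_block_mx add_block_mx !scaler0 !addr0.
- by rewrite oX oY scalar_mx_block.
- by rewrite mX mY mulmx_block !mul0mx !mulmx0 !addr0 !add0r.
Qed.

Lemma hom_row_mx T X Y (f : 'M_(mdim T, mdim X)) (g : 'M_(mdim T, mdim Y)) :
  hom f -> hom g -> @hom _ _ T (dsum X Y) (row_mx f g).
Proof.
move=> hf hg a; rewrite /= mul_mx_row mul_row_block !mulmx0 addr0 add0r.
by rewrite hf hg.
Qed.

Lemma hom_col_mx X Y T (f : 'M_(mdim X, mdim T)) (g : 'M_(mdim Y, mdim T)) :
  hom f -> hom g -> @hom _ _ (dsum X Y) T (col_mx f g).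
Proof.
move=> hf hg a; rewrite /= mul_block_col mul_col_mx !mul0mx addr0 add0r.
by rewrite hf hg.
Qed.

Lemma hom_lsub T X Y (f : 'M_(mdim T, mdim X + mdim Y)) :
  @hom _ _ T (dsum X Y) f ->
  @hom _ _ T X (lsubmx f) /\ @hom _ _ T Y (rsubmx f).
Proof.
rewrite -{1}(hsubmxK f) => hf.
suff E a : mact T a *m lsubmx f = lsubmx f *m mact X a /\
  mact T a *m rsubmx f = rsubmx f *m mact Y a by split=> a; case: (E a).
have /= := hf a; rewrite mul_mx_row mul_row_block !mulmx0 addr0 add0r.
by move=> /eq_row_mx.
Qed.

Lemma hom_usub X Y T (f : 'M_(mdim X + mdim Y, mdim T)) :
  @hom _ _ (dsum X Y) T f ->
  @hom _ _ X T (usubmx f) /\ @hom _ _ Y T (dsubmx f).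
Proof.
rewrite -{1}(vsubmxK f) => hf.
suff E a : mact X a *m usubmx f = usubmx f *m mact T a /\
  mact Y a *m dsubmx f = dsubmx f *m mact T a by split=> a; case: (E a).
have /= := hf a; rewrite mul_block_col mul_col_mx !mul0mx addr0 add0r.
by move=> /eq_col_mx.
Qed.

Lemma projective_dsum P Q :
  projective P -> projective Q -> projective (dsum P Q).
Proof.
move=> pP pQ X Y g h mX mY hg fg /hom_usub[h1 h2].
have [l1 [hl1 e1]] := pP _ _ g _ mX mY hg fg h1.
have [l2 [hl2 e2]] := pQ _ _ g _ mX mY hg fg h2.
exists (col_mx l1 l2); split; first exact: hom_col_mx.
by rewrite mul_col_mx e1 e2 vsubmxK.
Qed.

Lemma injective_dsum P Q :
  injective P -> injective Q -> injective (dsum P Q).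
Proof.
move=> pP pQ X Y g h mX mY hg fg /hom_lsub[h1 h2].
have [l1 [hl1 e1]] := pP _ _ g _ mX mY hg fg h1.
have [l2 [hl2 e2]] := pQ _ _ g _ mX mY hg fg h2.
exists (row_mx l1 l2); split; first exact: hom_row_mx.
by rewrite mul_mx_row e1 e2 hsubmxK.
Qed.

Lemma projective_retract P Q (i : 'M_(mdim P, mdim Q)) (r : 'M_(mdim Q, mdim P)) :
  hom i -> hom r -> i *m r = 1%:M -> projective Q -> projective P.
Proof.
move=> hi hr ir pQ X Y g h mX mY hg fg hh.
have [l [hl e]] := pQ _ _ g _ mX mY hg fg (homM hr hh).
by exists (i *m l); split; [exact: homM | rewrite -mulmxA e mulmxA ir mul1mx].
Qed.

Lemma injective_retract P Q (i : 'M_(mdim P, mdim Q)) (r : 'M_(mdim Q, mdim P)) :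
  hom i -> hom r -> i *m r = 1%:M -> injective Q -> injective P.
Proof.
move=> hi hr ir pQ X Y g h mX mY hg fg hh.
have [l [hl e]] := pQ _ _ g _ mX mY hg fg (homM hh hi).
by exists (l *m r); split; [exact: homM | rewrite mulmxA e -mulmxA ir mulmx1].
Qed.

Definition iso X Y : Prop :=
  exists (f : 'M_(mdim X, mdim Y)) (g : 'M_(mdim Y, mdim X)),
    [/\ hom f, hom g, f *m g = 1%:M & g *m f = 1%:M].

(** Matrices act on row vectors from the right: [row_free] means injective, [row_full] surjective,
    and the image of [f] is its row space. *)
Record ses X Y Z (f : 'M_(mdim X, mdim Y)) (g : 'M_(mdim Y, mdim Z)) : Prop := Ses {
  ses_modl : is_mod X;
  ses_modm : is_mod Y;
  ses_modr : is_mod Z;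
  ses_homl : hom f;
  ses_homr : hom g;
  ses_free : row_free f;
  ses_full : row_full g;
  ses_exact : (f == kermx g)%MS }.

Section ShortExact.
Variables (X Y Z : rmod A) (f : 'M[k]_(mdim X, mdim Y)) (g : 'M[k]_(mdim Y, mdim Z)).
Hypothesis S : ses f g.

Lemma ses_mul0 : f *m g = 0.
Proof. by apply/sub_kermxP; case/andP: (ses_exact S). Qed.

Lemma ses_lift T (h : 'M_(mdim T, mdim Y)) :
  hom h -> h *m g = 0 -> exists2 h' : 'M_(mdim T, mdim X), hom h' & h' *m f = h.
Proof.
move=> hh /sub_kermxP hg; have {}hg := submx_trans hg (proj2 (andP (ses_exact S))).
exists (h *m pinvmx f); last exact: mulmxKpV.
by apply: (hom_cancelr (ses_free S) (ses_homl S)); rewrite mulmxKpV.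
Qed.

Lemma ses_fact T (h : 'M_(mdim Y, mdim T)) :
  hom h -> f *m h = 0 -> exists2 h' : 'M_(mdim Z, mdim T), hom h' & g *m h' = h.
Proof.
move=> hh fh; have gg : pinvmx g *m g = 1%:M by apply: mulVpmx (ses_full S).
(* The linear section [pinvmx g] gives the factor: [1 - g *m pinvmx g] has its image in the kernel
   of [g], which is the image of [f] and is killed by [h]. *)
have e : g *m (pinvmx g *m h) = h.
  apply/eqP; rewrite -subr_eq0 -{2}[h]mul1mx mulmxA -mulmxBl.
  have /sub_kermxP : (g *m pinvmx g - 1%:M) *m g = 0.
    by rewrite mulmxBl -mulmxA gg mulmx1 mul1mx subrr.
  move=> s; have {s}/submxP[D ->] := submx_trans s (proj2 (andP (ses_exact S))).
  by rewrite -mulmxA fh mulmx0.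
exists (pinvmx g *m h) => //.
by apply: (hom_cancell (ses_full S) (ses_homr S)); rewrite e.
Qed.

Lemma ses_isor W (u : 'M_(mdim Z, mdim W)) (v : 'M_(mdim W, mdim Z)) :
  is_mod W -> hom u -> u *m v = 1%:M -> v *m u = 1%:M ->
  ses f (g *m u : 'M_(mdim Y, mdim W)).
Proof.
move=> mW hu uv vu; case: (S) => mX mY mZ hf hg ff fg ex; split=> //.
- exact: homM.
- apply/row_fullP; have /row_fullP[g' e] := fg; exists (v *m g').
  by rewrite mulmxA -[v *m g' *m g]mulmxA e mulmx1.
- have [e1 e2] := andP ex; apply/andP; split.
    by apply/sub_kermxP; rewrite mulmxA ses_mul0 mul0mx.
  apply: submx_trans e2; apply/sub_kermxP.
  by rewrite -[LHS]mulmx1 -uv mulmxA -[_ *m g *m u]mulmxA mulmx_ker mul0mx.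
Qed.

Lemma ses_isol W (u : 'M_(mdim W, mdim X)) (v : 'M_(mdim X, mdim W)) :
  is_mod W -> hom u -> u *m v = 1%:M -> v *m u = 1%:M ->
  ses (u *m f : 'M_(mdim W, mdim Y)) g.
Proof.
move=> mW hu uv vu; case: (S) => mX mY mZ hf hg ff fg ex; split=> //.
- exact: homM.
- apply/row_freeP; have /row_freeP[f' e] := ff; exists (f' *m v).
  by rewrite mulmxA -[u *m f *m f']mulmxA e mulmx1.
- have [e1 e2] := andP ex; apply/andP; split.
    exact: submx_trans (submxMl _ _) e1.
  apply: (submx_trans e2).
  by rewrite -[X in (X <= _)%MS]mul1mx -vu -mulmxA submxMl.
Qed.

Lemma ses_dsumr Q : is_mod Q ->
  @ses X (dsum Y Q) (dsum Z Q) (row_mx f 0) (block_mx g 0 0 1%:M).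
Proof.
move=> mQ; case: (S) => mX mY mZ hf hg ff fg ex.
have [e1 e2] := andP ex; split; try exact: dsum_mod; try by [].
- apply: hom_row_mx => //; exact: hom0.
- rewrite -[block_mx _ _ _ _]/(col_mx _ _); apply: hom_col_mx; apply: hom_row_mx => //.
  + exact: hom0.
  + exact: hom0.
  + exact: hom1.
- apply/row_freeP; have /row_freeP[f' e] := ff.
  by exists (col_mx f' 0); rewrite mul_row_col mul0mx addr0.
- apply/row_fullP; have /row_fullP[g' e] := fg.
  exists (block_mx g' 0 0 1%:M).
  by rewrite mulmx_block !mul0mx !mulmx0 !addr0 add0r e mul1mx -scalar_mx_block.
- apply/andP; split.
    apply/sub_kermxP.
    by rewrite mul_row_block !mul0mx !mulmx0 !addr0 ses_mul0 row_mx0.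
  set K := kermx _.
  have: K *m block_mx g 0 0 1%:M = 0 by exact: mulmx_ker.
  rewrite -(hsubmxK K) mul_row_block !mulmx0 !addr0 add0r mulmx1 -row_mx0.
  move=> /eq_row_mx[/sub_kermxP k1 ->].
  have /submxP[D ->] := submx_trans k1 e2.
  by apply/submxP; exists D; rewrite mul_mx_row mulmx0.
Qed.

Lemma ses_dsuml Q : is_mod Q ->
  @ses (dsum X Q) (dsum Y Q) Z (block_mx f 0 0 1%:M) (col_mx g 0).
Proof.
move=> mQ; case: (S) => mX mY mZ hf hg ff fg ex.
have [e1 e2] := andP ex; split; try exact: dsum_mod; try by [].
- rewrite -[block_mx _ _ _ _]/(col_mx _ _); apply: hom_col_mx; apply: hom_row_mx => //.
  + exact: hom0.
  + exact: hom0.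
  + exact: hom1.
- apply: hom_col_mx => //; exact: hom0.
- apply/row_freeP; have /row_freeP[f' e] := ff.
  exists (block_mx f' 0 0 1%:M).
  by rewrite mulmx_block !mul0mx !mulmx0 !addr0 add0r e mul1mx -scalar_mx_block.
- apply/row_fullP; have /row_fullP[g' e] := fg.
  by exists (row_mx g' 0); rewrite mul_row_col mul0mx addr0.
- apply/andP; split.
    apply/sub_kermxP.
    by rewrite mul_block_col !mul0mx !mulmx0 !addr0 ses_mul0 col_mx0.
  set K := kermx _.
  have: K *m col_mx g 0 = 0 by exact: mulmx_ker.
  rewrite -(hsubmxK K) mul_row_col !mulmx0 !addr0.
  move=> /sub_kermxP k1.
  have /submxP[D ->] := submx_trans k1 e2.
  apply/submxP; exists (row_mx D (rsubmx K)).
  by rewrite mul_row_block !mulmx0 !addr0 add0r mulmx1.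
Qed.

End ShortExact.

(* Both isomorphisms of Schanuel's lemma are written down as 2 x 2 block matrices,
   which avoids pullbacks and pushouts. *)
Lemma schanuel_proj N1 P1 N2 P2 W
    (f1 : 'M_(mdim N1, mdim P1)) (g1 : 'M_(mdim P1, mdim W))
    (f2 : 'M_(mdim N2, mdim P2)) (g2 : 'M_(mdim P2, mdim W)) :
  ses f1 g1 -> ses f2 g2 -> projective P1 -> projective P2 ->
  iso (dsum N1 P2) (dsum N2 P1).
Proof.
move=> S1 S2 p1 p2.
have [al [hal eal]] := p1 _ _ g2 g1 (ses_modm S2) (ses_modr S2) (ses_homr S2) (ses_full S2) (ses_homr S1).
have [be [hbe ebe]] := p2 _ _ g1 g2 (ses_modm S1) (ses_modr S1) (ses_homr S1) (ses_full S1) (ses_homr S2).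
have [u hu eu] := ses_lift S2 (homM (ses_homl S1) hal) ltac:(by rewrite -mulmxA eal ses_mul0).
have [u' hu' eu'] := ses_lift S1 (homM (ses_homl S2) hbe) ltac:(by rewrite -mulmxA ebe ses_mul0).
(* The lifts [al] and [be] need not be mutually inverse, but [1 - be *m al] is killed by [g2]. Its
   factor [w] through [f2] is the correcting block; [w'] plays the same part on [P1]. *)
have [w hw ew] := ses_lift S2 (homD (hom1 P2) (homN (homM hbe hal)))
  ltac:(by rewrite mulmxDl mulNmx -mulmxA eal ebe mul1mx subrr).
have [w' hw' ew'] := ses_lift S1 (homD (hom1 P1) (homN (homM hal hbe)))
  ltac:(by rewrite mulmxDl mulNmx -mulmxA ebe eal mul1mx subrr).
exists (block_mx (- u) f1 w be), (block_mx (- u') f2 w' al); split.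
- by rewrite -[block_mx _ _ _ _]/(col_mx _ _); apply: hom_col_mx;
    apply: hom_row_mx => //; [exact: homN | exact: ses_homl S1].
- by rewrite -[block_mx _ _ _ _]/(col_mx _ _); apply: hom_col_mx;
    apply: hom_row_mx => //; [exact: homN | exact: ses_homl S2].
- rewrite mulmx_block (@scalar_mx_block _ (mdim N1) (mdim P2)); congr block_mx.
  + apply: (row_free_inj (ses_free S1)).
    by rewrite mulNmx mulmxN opprK mulmxDl -!mulmxA eu' ew' mulmxDr mulmxN !mulmxA eu mulmx1 mul1mx addrCA subrr addr0.
  + by rewrite mulNmx eu addNr.
  + apply: (row_free_inj (ses_free S1)).
    rewrite mul0mx mulmxN mulmxDl mulNmx -!mulmxA eu' ew' mulmxA ew.
    by rewrite mulmxDl mulmxDr mul1mx mulmx1 mulmxN mulNmx !mulmxA addNr.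
  + by rewrite ew subrK.
- rewrite mulmx_block (@scalar_mx_block _ (mdim N2) (mdim P1)); congr block_mx.
  + apply: (row_free_inj (ses_free S2)).
    by rewrite mulNmx mulmxN opprK mulmxDl -!mulmxA eu ew mulmxDr mulmxN !mulmxA eu' mulmx1 mul1mx addrCA subrr addr0.
  + by rewrite mulNmx eu' addNr.
  + apply: (row_free_inj (ses_free S2)).
    rewrite mul0mx mulmxN mulmxDl mulNmx -!mulmxA eu ew mulmxA ew'.
    by rewrite mulmxDl mulmxDr mul1mx mulmx1 mulmxN mulNmx !mulmxA addNr.
  + by rewrite ew' subrK.
Qed.

Lemma schanuel_inj W I1 Z1 I2 Z2
    (f1 : 'M_(mdim W, mdim I1)) (g1 : 'M_(mdim I1, mdim Z1))
    (f2 : 'M_(mdim W, mdim I2)) (g2 : 'M_(mdim I2, mdim Z2)) :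
  ses f1 g1 -> ses f2 g2 -> injective I1 -> injective I2 ->
  iso (dsum Z1 I2) (dsum Z2 I1).
Proof.
move=> S1 S2 i1 i2.
have [al [hal eal]] := i2 _ _ f1 f2 (ses_modl S1) (ses_modm S1) (ses_homl S1) (ses_free S1) (ses_homl S2).
have [be [hbe ebe]] := i1 _ _ f2 f1 (ses_modl S2) (ses_modm S2) (ses_homl S2) (ses_free S2) (ses_homl S1).
have [u hu eu] := ses_fact S1 (homM hal (ses_homr S2)) ltac:(by rewrite mulmxA eal ses_mul0).
have [u' hu' eu'] := ses_fact S2 (homM hbe (ses_homr S1)) ltac:(by rewrite mulmxA ebe ses_mul0).
have [w hw ew] := ses_fact S1 (homD (hom1 I1) (homN (homM hal hbe)))
  ltac:(by rewrite mulmxDr mulmxN mulmxA eal ebe mulmx1 subrr).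
have [w' hw' ew'] := ses_fact S2 (homD (hom1 I2) (homN (homM hbe hal)))
  ltac:(by rewrite mulmxDr mulmxN mulmxA ebe eal mulmx1 subrr).
exists (block_mx (- u) w g2 be), (block_mx (- u') w' g1 al); split.
- by rewrite -[block_mx _ _ _ _]/(col_mx _ _); apply: hom_col_mx;
    apply: hom_row_mx => //; [exact: homN | exact: ses_homr S2].
- by rewrite -[block_mx _ _ _ _]/(col_mx _ _); apply: hom_col_mx;
    apply: hom_row_mx => //; [exact: homN | exact: ses_homr S1].
- rewrite mulmx_block (@scalar_mx_block _ (mdim Z1) (mdim I2)); congr block_mx.
  + apply: (row_full_inj (ses_full S1)).
    rewrite mulNmx mulmxN opprK mulmxDr !mulmxA eu ew -mulmxA eu' mulmxA.
    by rewrite mulmxDl mulNmx mulmx1 mul1mx addrCA subrr addr0.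
  + apply: (row_full_inj (ses_full S1)).
    rewrite mulmx0 mulNmx mulmxDr mulmxN !mulmxA eu ew -mulmxA ew'.
    by rewrite mulmxDl mulmxDr mulmxN mulNmx !mulmxA mul1mx mulmx1 addNr.
  + by rewrite mulmxN eu' addNr.
  + by rewrite ew' subrK.
- rewrite mulmx_block (@scalar_mx_block _ (mdim Z2) (mdim I1)); congr block_mx.
  + apply: (row_full_inj (ses_full S2)).
    rewrite mulNmx mulmxN opprK mulmxDr !mulmxA eu' ew' -mulmxA eu mulmxA.
    by rewrite mulmxDl mulNmx mulmx1 mul1mx addrCA subrr addr0.
  + apply: (row_full_inj (ses_full S2)).
    rewrite mulmx0 mulNmx mulmxDr mulmxN !mulmxA eu' ew' -mulmxA ew.
    by rewrite mulmxDl mulmxDr mulmxN mulNmx !mulmxA mul1mx mulmx1 addNr.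
  + by rewrite mulmxN eu addNr.
  + by rewrite ew subrK.
Qed.

(** * Stable isomorphism under syzygies and cosyzygies *)

Definition stab X Y : Prop :=
  exists P Q, [/\ is_mod P, is_mod Q, projective P, projective Q &
                  iso (dsum X P) (dsum Y Q)].

(** Adding projectives to the middle and right terms makes the right ends isomorphic without
    changing [N] and [N']; Schanuel's lemma then compares the left ends. *)
Lemma stab_syzygy N P M N' P' M'
    (f : 'M_(mdim N, mdim P)) (g : 'M_(mdim P, mdim M))
    (f' : 'M_(mdim N', mdim P')) (g' : 'M_(mdim P', mdim M')) :
  ses f g -> ses f' g' -> projective P -> projective P' ->
  stab M M' -> stab N N'.
Proof.
move=> S S' pP pP' [Q [Q' [mQ mQ' pQ pQ' [u [v [hu hv uv vu]]]]]].
have T := ses_isor (ses_dsumr S mQ) (dsum_mod (ses_modr S') mQ') hu uv vu.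
have T' := ses_dsumr S' mQ'.
have I := schanuel_proj T T' (projective_dsum pP pQ) (projective_dsum pP' pQ').
exists (dsum P' Q'), (dsum P Q); split=> //; try exact: projective_dsum.
- exact: dsum_mod (ses_modm S') mQ'.
- exact: dsum_mod (ses_modm S) mQ.
Qed.

(** The dual argument: projectives are added to the left and middle terms, and the middle terms are
    injective by assumption. *)
Lemma stab_cosyzygy N P M N' P' M'
    (f : 'M_(mdim N, mdim P)) (g : 'M_(mdim P, mdim M))
    (f' : 'M_(mdim N', mdim P')) (g' : 'M_(mdim P', mdim M')) :
  (forall Q, is_mod Q -> projective Q -> injective Q) ->
  ses f g -> ses f' g' -> projective P -> projective P' ->
  stab N N' -> stab M M'.
Proof.
move=> PI S S' pP pP' [Q [Q' [mQ mQ' pQ pQ' [u [v [hu hv uv vu]]]]]].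
have T := ses_dsuml S mQ.
have T' := ses_isol (ses_dsuml S' mQ') (dsum_mod (ses_modl S) mQ) hu uv vu.
have m1 := dsum_mod (ses_modm S) mQ; have m2 := dsum_mod (ses_modm S') mQ'.
have p1 := projective_dsum pP pQ; have p2 := projective_dsum pP' pQ'.
have I := schanuel_inj T T' (PI _ m1 p1) (PI _ m2 p2).
by exists (dsum P' Q'), (dsum P Q).
Qed.

(** * Submodules, kernels and syzygies *)

Section Submodule.
Variables (X : rmod A) (n : nat) (D : 'M[k]_(n, mdim X)).

(** The basis [row_base D] identifies the row space of [D] with a space of row vectors; the
    pseudo-inverse reads off coordinates in this basis. *)
Definition submod : rmod A :=
  RMod (fun a => row_base D *m mact X a *m pinvmx (row_base D)).

Hypothesis mX : is_mod X.
Hypothesis stD : forall a, (D *m mact X a <= D)%MS.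

Lemma submod_hom : @hom _ _ submod X (row_base D).
Proof.
move=> a; rewrite /= mulmxKpV // eq_row_base.
apply: submx_trans (stD a); apply: submxMr; by rewrite eq_row_base.
Qed.

Lemma submod_mod : is_mod submod.
Proof.
have [lX oX mulX] := mX; have inj := @row_free_inj _ _ _ _ _ (row_base_free D).
have h := submod_hom; rewrite /hom /= in h.
split=> [c a b||a b]; apply: inj.
- by rewrite /= mulmxDl -scalemxAl !h lX mulmxDr -scalemxAr.
- by rewrite h oX mulmx1 mul1mx.
- by rewrite /= h mulX -mulmxA h [RHS]mulmxA h mulmxA.
Qed.

End Submodule.

Lemma kernel_ses X Z (g : 'M_(mdim X, mdim Z)) :
  is_mod X -> is_mod Z -> hom g -> row_full g ->
  exists N (f : 'M_(mdim N, mdim X)), ses f g.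
Proof.
move=> mX mZ hg fg; exists (submod (kermx g)), (row_base (kermx g)).
have st a : (kermx g *m mact X a <= kermx g)%MS.
  by apply/sub_kermxP; rewrite -mulmxA hg mulmxA mulmx_ker mul0mx.
split=> //; first exact: submod_mod.
- exact: submod_hom.
- exact: row_base_free.
- by rewrite !eq_row_base submx_refl.
Qed.

Lemma image_factor Y X (h : 'M_(mdim Y, mdim X)) :
  is_mod Y -> is_mod X -> hom h ->
  is_mod (submod h) /\ exists g : 'M_(mdim Y, mdim (submod h)),
    [/\ hom g, row_full g & g *m row_base h = h].
Proof.
move=> mY mX hh.
have st a : (h *m mact X a <= h)%MS by rewrite -hh submxMl.
split; first exact: submod_mod.
have e : h *m pinvmx (row_base h) *m row_base h = h by rewrite mulmxKpV // eq_row_base.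
exists (h *m pinvmx (row_base h)); split=> //.
  by apply: (@hom_cancelr Y (submod h) X _ _ (row_base_free h) (submod_hom st)); rewrite e.
rewrite /row_full eqn_leq rank_leq_col.
have /= := mxrankM_maxl (h *m pinvmx (row_base h)) (row_base h); by rewrite e.
Qed.

Lemma syzygies M (P : nat -> rmod A) (d : forall t, 'M_(mdim (P t.+1), mdim (P t)))
    (* The higher syzygies are taken as images of the differentials, which by exactness are the
       kernels of the preceding maps. *)
    (e : 'M_(mdim (P 0%N), mdim M)) : is_mod M -> proj_res d e ->
  exists2 N : nat -> rmod A, N 0%N = M &
    forall t, exists (f : 'M_(mdim (N t.+1), mdim (P t))) (g : 'M_(mdim (P t), mdim (N t))),
      ses f g.
Proof.
move=> mM [mP [pP [[he fe] [hd [d0 dS]]]]].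
pose N t := if t is s.+1 then submod (d s) else M.
have im s := image_factor (mP s.+1) (mP s) (hd s).
have st s a : (d s *m mact (P s) a <= d s)%MS by rewrite -hd submxMl.
have h1 s := submod_hom (st s).
exists N => // -[|s] /=.
  exists (row_base (d 0%N)), e; split=> //; first by case: (im 0%N).
    exact: row_base_free.
  by rewrite !eq_row_base.
have [ms [g [hg fg eg]]] := im s.
exists (row_base (d s.+1)), g; split=> //; first by case: (im s.+1).
  exact: row_base_free.
rewrite !eq_row_base; have [e1 e2] := andP (dS s); apply/andP; split.
  apply/sub_kermxP; apply: (row_free_inj (row_base_free (d s))).
  by rewrite mul0mx -mulmxA eg; apply/sub_kermxP.
apply: submx_trans e2; apply/sub_kermxP.
by have := congr1 (mulmx (kermx g)) eg; rewrite mulmxA mulmx_ker mul0mx.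
Qed.

(** [M] can replace [N] while [Z] stays fixed. After adding [Q2], the sum of [M] and [Q1] embeds in
    [R = dsum P Q2]; the injective [Q1] splits off, and a complement [K] is a projective module
    containing [M] with cokernel [Z]. *)
Lemma ses_stab N P Z M (f : 'M_(mdim N, mdim P)) (g : 'M_(mdim P, mdim Z)) :
  (forall Q, is_mod Q -> projective Q -> injective Q) ->
  ses f g -> projective P -> is_mod M -> stab M N ->
  exists P' (f' : 'M_(mdim M, mdim P')) (g' : 'M_(mdim P', mdim Z)),
    projective P' /\ ses f' g'.
Proof.
move=> PI S pP mM [Q1 [Q2 [mQ1 mQ2 pQ1 pQ2 [u [v [hu hv uv vu]]]]]].
have := ses_isol (ses_dsuml S mQ2) (dsum_mod mM mQ1) hu uv vu.
set F := _ *m _; set R := dsum P Q2 => SF.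
set G := (G in ses _ G) in SF.
have pR : projective R by exact: projective_dsum.
have mR : is_mod R by exact: ses_modm SF.
pose fM := usubmx F; pose fQ := dsubmx F.
have FE : F = col_mx fM fQ by rewrite vsubmxK.
have [hM hQ] : @hom _ _ M R fM /\ @hom _ _ Q1 R fQ by apply: hom_usub (ses_homl SF).
have hpr : @hom _ _ (dsum M Q1) Q1 (col_mx 0 1%:M).
  apply: hom_col_mx; [exact: hom0|exact: hom1].
(* [r] extends the projection onto [Q1] to [R]; hence it splits [fQ] and kills the image of [M],
   which therefore lies in its kernel [K]. *)
have [r [hr er]] := PI _ mQ1 pQ1 _ _ _ _ (dsum_mod mM mQ1) mR (ses_homl SF) (ses_free SF) hpr.
move: (er); rewrite FE mul_col_mx => /eq_col_mx[rM rQ].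
have fr : row_full r by apply/row_fullP; exists fQ.
have [K [ka Ska]] := kernel_ses mR mQ1 hr fr.
have [m hm em] := ses_lift Ska hM rM.
have hs : @hom _ _ R R (1%:M - r *m fQ).
  by apply: (@homD R R); [exact: hom1 | apply: (@homN R R); exact: homM].
have [p hp ep] := ses_lift Ska hs ltac:(by rewrite mulmxBl mul1mx -mulmxA rQ mulmx1 subrr).
have kp : ka *m p = 1%:M.
  apply: (row_free_inj (ses_free Ska)).
  by rewrite mul1mx -mulmxA ep mulmxBr mulmx1 mulmxA (ses_mul0 Ska) mul0mx subr0.
have FG0 := ses_mul0 SF.
move: (FG0); rewrite {1}FE mul_col_mx -col_mx0 => /eq_col_mx[MG QG].
exists K, m, (ka *m G); split.
  exact: projective_retract (ses_homl Ska) hp kp pR.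
have fm : row_free m.
  apply/row_freeP; have /row_freeP[F' FF'] := ses_free SF.
  move: FF'; rewrite FE mul_col_mx -(hsubmxK F') !mul_mx_row -[col_mx _ _]/(block_mx _ _ _ _).
  rewrite (@scalar_mx_block _ (mdim M) (mdim Q1)) => /eq_block_mx[E _ _ _].
  by exists (ka *m lsubmx F'); rewrite mulmxA em.
have fG : row_full (ka *m G).
  apply/row_fullP; have /row_fullP[G' GG'] := ses_full SF; exists (G' *m p).
  rewrite -GG' -mulmxA; congr (_ *m _).
  by rewrite mulmxA ep mulmxBl mul1mx -mulmxA QG mulmx0 subr0.
split=> //; [exact: ses_modl Ska | exact: ses_modr SF | | ].
  exact: homM (ses_homl Ska) (ses_homr SF).
apply/andP; split; first by apply/sub_kermxP; rewrite mulmxA em MG.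
set x := kermx _.
have: x *m ka *m G = 0 by rewrite -mulmxA mulmx_ker.
move/sub_kermxP => xk; have /submxP[y] := submx_trans xk (proj2 (andP (ses_exact SF))).
rewrite FE -(hsubmxK y) mul_row_col => ey.
(* Applying [r] isolates the [Q1] component of [y], and [r] vanishes on [K]. *)
have y2 : rsubmx y = 0.
  have: x *m ka *m r = 0 by rewrite -mulmxA (ses_mul0 Ska) mulmx0.
  by rewrite ey mulmxDl -!mulmxA rM rQ mulmx0 add0r mulmx1.
apply/submxP; exists (lsubmx y); apply: (row_free_inj (ses_free Ska)).
by rewrite ey y2 mul0mx addr0 -mulmxA em.
Qed.

(** * Projective modules over a self-injective algebra are injective *)

Local Notation adim := (\dim (fullv : {vspace A})).
Local Notation bas := (tnth (vbasis (fullv : {vspace A}))).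
Local Notation crd := (coord (vbasis (fullv : {vspace A}))).

Lemma linear_coord (V : lmodType k) (phi : A -> V) (a : A) :
  (forall (c : k) a b, phi (c *: a + b) = c *: phi a + phi b) ->
  phi a = \sum_j crd j a *: phi (bas j).
Proof.
move=> lphi.
have phi0 : phi 0 = 0.
  have := lphi (-1) 0 0; rewrite scaler0 addr0 scaleN1r => ->.
  by rewrite addNr.
rewrite {1}(coord_vbasis (memvf a)).
elim/big_rec2: _ => [//|j y x _ <-].
by rewrite lphi (tnth_nth 0).
Qed.

Lemma crd_bas i j : crd j (bas i) = (i == j)%:R.
Proof. by rewrite (tnth_nth 0) coord_free ?(basis_free (vbasisP _)) // eq_sym. Qed.

Lemma regmod_mod : is_mod (regmod A).
Proof.
split=> [c a b||a b]; apply/matrixP => i j.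
- by rewrite !mxE mulrDr -scalerAr linearP.
- by rewrite !mxE mulr1 crd_bas.
- rewrite !mxE mulrA.
  rewrite (@linear_coord _ (fun x => crd j (x * b) : k^o)); last first.
    by move=> c x y; rewrite mulrDl -scalerAl linearP.
  by apply: eq_bigr => l _; rewrite !mxE.
Qed.

(** [F] is a direct sum of copies of the regular module, one for each basis vector of [P], and is
    injective because the regular module is. *)
Lemma free_cover P : self_injective A -> is_mod P ->
  exists F (g : 'M_(mdim F, mdim P)),
    [/\ is_mod F, injective F, hom g & row_full g].
Proof.
move=> AI mP; have [lP oP mulP] := mP.
suff /(_ (mdim P) (leqnn _))[F [g [mF iF hg sg]]] : forall n, (n <= mdim P)%N ->
  exists F (g : 'M_(mdim F, mdim P)), [/\ is_mod F, injective F, hom g &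
    forall i : 'I_(mdim P), (i < n)%N -> ((delta_mx 0 i : 'rV_(mdim P)) <= g)%MS].
  exists F, g; split=> //; rewrite -sub1mx; apply/row_subP => i.
  by rewrite row1; apply: sg.
elim=> [_|n IH ltn].
  exists (RMod (fun _ : A => 0 : 'M_0)), 0; split=> //.
  - by split=> [c a b||a b]; exact: flatmx0_eq || (apply/matrixP; case).
  - move=> X Y g h _ _ _ _ _; exists 0; split; first exact: hom0.
    by rewrite mulmx0; apply/matrixP => ? [].
  - exact: hom0.
have [F [g [mF iF hg sg]]] := IH (ltnW ltn).
pose i0 := Ordinal ltn.
(* The homomorphism sending [a] to the basis vector [i0] times [a]; it reaches that vector at
   [a = 1]. *)
pose gi : 'M_(mdim (regmod A), mdim P) := \matrix_j (row i0 (mact P (bas j))).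
have giE x : \sum_j crd j x *: row i0 (mact P (bas j)) = row i0 (mact P x).
  rewrite [RHS](@linear_coord _ (fun x => row i0 (mact P x))) //.
  by move=> c a b; rewrite lP linearP.
have hgi : hom gi.
  move=> a; apply/row_matrixP => j; rewrite !row_mul rowK -[RHS]row_mul -mulP -giE.
  by rewrite mulmx_sum_row; apply: eq_bigr => l _; rewrite rowK !mxE.
exists (dsum (regmod A) F), (col_mx gi g); split.
- exact: dsum_mod regmod_mod mF.
- exact: injective_dsum.
- exact: hom_col_mx.
move=> i; rewrite ltnS leq_eqVlt => /orP[/eqP ei|lti].
  have -> : i = i0 by exact: val_inj.
  apply: (@submx_trans _ _ _ _ _ _ gi); last by rewrite -addsmxE addsmxSl.
  apply/submxP; exists (\row_j crd j 1).
  rewrite mulmx_sum_row -row1 -oP -giE.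
  by apply: eq_bigr => l _; rewrite rowK !mxE.
apply: submx_trans (sg _ lti) _; by rewrite -addsmxE addsmxSr.
Qed.

Lemma projective_injective P :
  self_injective A -> is_mod P -> projective P -> injective P.
Proof.
move=> AI mP pP; have [F [g [mF iF hg fg]]] := free_cover AI mP.
have [s [hs es]] := pP _ _ g 1%:M mF mP hg fg (hom1 P).
exact: injective_retract hs hg es iF.
Qed.

(** * Coinduced modules and averaging of linear maps into an injective module *)

Definition lregmx (a : A) : 'M[k]_adim := \matrix_(i, j) crd j (a * bas i).

Lemma lregmxE (n : nat) (phi : A -> 'rV[k]_n) a :
  (forall (c : k) a b, phi (c *: a + b) = c *: phi a + phi b) ->
  lregmx a *m (\matrix_i phi (bas i)) = \matrix_i phi (a * bas i).
Proof.
move=> lphi; apply/row_matrixP => i; rewrite row_mul rowK mulmx_sum_row.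
rewrite [RHS](@linear_coord _ phi) //.
by apply: eq_bigr => j _; rewrite rowK !mxE.
Qed.

(* The right module Hom_k(A, k^n), with (f . a)(b) = f (a b); a linear map f is the
   matrix of its values on the basis. *)
Definition coind (n : nat) : rmod A := RMod (fun a => lin_mulmx (lregmx a) : 'M_(adim * n)).

Lemma coind_mod n : is_mod (coind n).
Proof.
have E (B C : 'M[k]_(adim * n)) : (forall G, mxvec G *m B = mxvec G *m C) -> B = C.
  by move=> H; apply/row_matrixP => i; rewrite !rowE -[delta_mx 0 i]vec_mxK.
split=> [c a b||a b] /=.
- apply: E => G; rewrite mulmxDr -scalemxAr !mul_vec_lin /= -linearP scalemxAl -mulmxDl.
  congr (mxvec (_ *m _)); apply/matrixP => i j.
  by rewrite !mxE mulrDl -scalerAl linearP.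
- apply: E => G; rewrite mulmx1 mul_vec_lin /=; congr mxvec.
  rewrite -[RHS]mul1mx; congr (_ *m _); apply/matrixP => i j.
  by rewrite !mxE mul1r crd_bas.
- apply: E => G; rewrite mulmxA !mul_vec_lin /= mulmxA; congr (mxvec (_ *m _)).
  apply/matrixP => i j; rewrite !mxE -mulrA.
  rewrite (@linear_coord _ (fun x => crd j (a * x) : k^o)); last first.
    by move=> c x y; rewrite mulrDr -scalerAr linearP.
  by apply: eq_bigr => l _; rewrite !mxE.
Qed.

(* The R_i are the components of a retraction of the embedding P -> Hom_k(A, P). *)
Lemma injective_casimir P : is_mod P -> injective P ->
  exists R : 'I_adim -> 'M[k]_(mdim P),
    \sum_i mact P (bas i) *m R i = 1%:M /\
    forall n (F : A -> 'M[k]_(n, mdim P)) a,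
      (forall (c : k) a b, F (c *: a + b) = c *: F a + F b) ->
      \sum_i F (a * bas i) *m R i = (\sum_i F (bas i) *m R i) *m mact P a.
Proof.
move=> mP iP; have [lP oP mulP] := mP; set p := mdim P in iP *.
(* [e] sends [v] to the map taking [b] to [v] times [b]. It is injective since [v] is recovered at
   [b = 1], so it has a retraction [l]. *)
pose e : 'M_(mdim P, mdim (coind p)) := \matrix_r mxvec (\matrix_i row r (mact P (bas i))).
have eE (v : 'rV_p) : v *m e = mxvec (\matrix_i (v *m mact P (bas i))).
  rewrite mulmx_sum_row.
  transitivity (mxvec (\sum_r v 0 r *: (\matrix_i row r (mact P (bas i)) : 'M_(adim, p)))).
    by rewrite linear_sum; apply: eq_bigr => r _; rewrite rowK linearZ.
  congr mxvec; apply/row_matrixP => i; rewrite rowK mulmx_sum_row linear_sum.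
  by apply: eq_bigr => r _; rewrite linearZ /= rowK.
have he : hom e.
  move=> a; apply/row_matrixP => r; rewrite !row_mul eE rowK /= mul_vec_lin /=.
  rewrite (@lregmxE _ (fun x => row r (mact P x))); last by move=> c x y; rewrite lP linearP.
  by congr mxvec; apply/row_matrixP => i; rewrite !rowK -row_mul mulP.
have fe : row_free e.
  apply: inj_row_free => v; rewrite eE => /(congr1 vec_mx); rewrite mxvecK linear0 => /matrixP v0.
  rewrite -[v]mulmx1 -oP (@linear_coord _ (fun x => v *m mact P x)); last first.
    by move=> c x y; rewrite lP mulmxDr scalemxAr.
  rewrite big1 // => i _; suff -> : v *m mact P (bas i) = 0 by rewrite scaler0.
  by apply/rowP => j; have := v0 i j; rewrite !mxE.
have [l [hl el]] := iP P (coind p) e 1%:M mP (coind_mod p) he fe (hom1 P).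
pose R i : 'M[k]_p := \matrix_s (mxvec (delta_mx i s) *m l).
have RE (G : 'M[k]_(adim, p)) : \sum_i row i G *m R i = mxvec G *m l.
  rewrite {2}[G]matrix_sum_delta linear_sum mulmx_suml; apply: eq_bigr => i _.
  rewrite linear_sum mulmx_suml mulmx_sum_row; apply: eq_bigr => s _.
  by rewrite rowK linearZ -scalemxAl !mxE.
have RF n (F : A -> 'M[k]_(n, p)) r (phi : 'I_adim -> A) :
    row r (\sum_i F (phi i) *m R i) = mxvec (\matrix_i row r (F (phi i))) *m l.
  by rewrite linear_sum -RE; apply: eq_bigr => i _; rewrite /= row_mul rowK.
exists R; split.
  apply/row_matrixP => r; rewrite (RF _ (mact P)) -el row_mul; congr (_ *m _).
  by rewrite rowK.
(* Each row of [F] is an element of [coind p], and passing from [F b] to [F (a * b)] is the action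
   of [a] on it; the identity is the linearity of [l] over [A]. *)
move=> n F a lF; apply/row_matrixP => r; rewrite row_mul !RF.
rewrite -(@lregmxE _ (fun x => row r (F x))); last by move=> c x y; rewrite lF linearP.
have := hl a; rewrite /= => hla; rewrite -mulmxA -hla mulmxA.
by rewrite mul_vec_lin.
Qed.

(** * Germs of rational functions on the module variety *)

Section Germs.
Variables (D : nat) (rho0 : A -> 'M[k]_D).
Implicit Types (S : (A -> 'M[k]_D) -> Prop) (phi psi : (A -> 'M[k]_D) -> k).

(** The sets where one polynomial does not vanish form a base of the Zariski topology; only points
    of the module variety are tested. *)
Definition near S : Prop :=
  exists u : pexpr k (mvvar A D), peval (mvcoord rho0) u != 0 /\
    forall rho, is_rep rho -> peval (mvcoord rho) u != 0 -> S rho.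

Lemma near_all S : (forall rho, is_rep rho -> S rho) -> near S.
Proof. by move=> H; exists (PC _ 1); split=> [|rho r _]; [exact: oner_neq0 | exact: H]. Qed.

Lemma near_and S S' : near S -> near S' -> near (fun rho => S rho /\ S' rho).
Proof.
move=> [u [u0 H]] [u' [u0' H']]; exists (PMul u u'); split=> /= [|rho r].
  by rewrite mulf_neq0.
by rewrite mulf_eq0 negb_or => /andP[n n']; split; [exact: H | exact: H'].
Qed.

Lemma near_imp S S' : (forall rho, is_rep rho -> S rho -> S' rho) -> near S -> near S'.
Proof. by move=> H [u [u0 Hu]]; exists u; split=> // rho r n; apply: H => //; exact: Hu. Qed.

(** Regularity at the point [rho0]. The polynomial [u] is both the denominator and the equation of
    the excluded locus, so shrinking the neighbourhood multiplies [v] and [u] by a common factor. *)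
Definition reg phi : Prop :=
  exists v u : pexpr k (mvvar A D), peval (mvcoord rho0) u != 0 /\
    forall rho, is_rep rho -> peval (mvcoord rho) u != 0 ->
      phi rho = peval (mvcoord rho) v / peval (mvcoord rho) u.

Lemma reg_near phi psi : near (fun rho => phi rho = psi rho) -> reg phi -> reg psi.
Proof.
move=> [w [w0 Hw]] [v [u [u0 H]]]; exists (PMul v w), (PMul u w).
split=> /= [|rho r]; first by rewrite mulf_neq0.
rewrite mulf_eq0 negb_or => /andP[n n']; rewrite -Hw // H //.
by rewrite -mulf_div divff // mulr1.
Qed.

Lemma reg_eq phi psi : (forall rho, is_rep rho -> phi rho = psi rho) -> reg phi -> reg psi.
Proof. by move=> H; apply: reg_near; exact: near_all. Qed.

Lemma regC c : reg (fun=> c).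
Proof.
exists (PC _ c), (PC _ 1); split=> /= [|rho _ _]; first exact: oner_neq0.
by rewrite divr1.
Qed.

Lemma regD phi psi : reg phi -> reg psi -> reg (fun rho => phi rho + psi rho).
Proof.
move=> [v [u [u0 H]]] [v' [u' [u0' H']]].
exists (PAdd (PMul v u') (PMul v' u)), (PMul u u').
split=> /= [|rho r]; first by rewrite mulf_neq0.
by rewrite mulf_eq0 negb_or => /andP[n n']; rewrite H // H' // addf_div.
Qed.

Lemma regM phi psi : reg phi -> reg psi -> reg (fun rho => phi rho * psi rho).
Proof.
move=> [v [u [u0 H]]] [v' [u' [u0' H']]]; exists (PMul v v'), (PMul u u').
split=> /= [|rho r]; first by rewrite mulf_neq0.
by rewrite mulf_eq0 negb_or => /andP[n n']; rewrite H // H' // mulf_div.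
Qed.

Lemma reg_sum (I : Type) (s : seq I) (F : I -> (A -> 'M[k]_D) -> k) :
  (forall i, reg (F i)) -> reg (fun rho => \sum_(i <- s) F i rho).
Proof.
move=> H; elim: s => [|i s IH].
  by apply: reg_eq (regC 0) => rho _; rewrite big_nil.
by apply: reg_eq (regD (H i) IH) => rho _; rewrite big_cons.
Qed.

Lemma reg_prod (I : Type) (s : seq I) (F : I -> (A -> 'M[k]_D) -> k) :
  (forall i, reg (F i)) -> reg (fun rho => \prod_(i <- s) F i rho).
Proof.
move=> H; elim: s => [|i s IH].
  by apply: reg_eq (regC 1) => rho _; rewrite big_nil.
by apply: reg_eq (regM (H i) IH) => rho _; rewrite big_cons.
Qed.

Lemma reg_peval n (T : (A -> 'M[k]_D) -> A -> 'M[k]_n) (p : pexpr k (mvvar A n)) :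
  (forall a i j, reg (fun rho => T rho a i j)) ->
  reg (fun rho => peval (mvcoord (T rho)) p).
Proof.
move=> H; elim: p => [c|[[i r] c]|p IHp q IHq|p IHp q IHq] /=.
- exact: regC.
- exact: H.
- exact: regD.
- exact: regM.
Qed.

Hypothesis r0 : is_rep rho0.

Lemma reg_neq0 phi : reg phi -> phi rho0 != 0 -> near (fun rho => phi rho != 0).
Proof.
move=> [v [u [u0 H]]]; rewrite H // mulf_eq0 negb_or => /andP[v0 _].
exists (PMul u v); split=> /= [|rho r]; first by rewrite mulf_neq0.
rewrite mulf_eq0 negb_or => /andP[n n'].
by rewrite H // mulf_neq0 // invr_eq0.
Qed.

Lemma regV phi : reg phi -> phi rho0 != 0 -> reg (fun rho => (phi rho)^-1).
Proof.
move=> [v [u [u0 H]]]; rewrite H // mulf_eq0 negb_or => /andP[v0 _].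
(* The inverse of [v / u] is expanded by [u], so that the new denominator also excludes the zeros of
   [u], where the formula for [phi] is not known. *)
exists (PMul u u), (PMul u v); split=> /= [|rho r]; first by rewrite mulf_neq0.
rewrite mulf_eq0 negb_or => /andP[n n']; rewrite H // invf_div.
by rewrite -mulf_div divff // mul1r.
Qed.

Lemma reg_entry a i j : reg (fun rho => rho a i j).
Proof.
apply: (@reg_eq (fun rho => \sum_l crd l a * rho (bas l) i j)).
  move=> rho [lr _ _]; rewrite [in RHS](@linear_coord _ rho a) // summxE.
  by apply: eq_bigr => l _; rewrite mxE.
apply: reg_sum => l; apply: regM; first exact: regC.
exists (PX _ (l, i, j)), (PC _ 1); split=> /= [|rho _ _]; first exact: oner_neq0.
by rewrite divr1.
Qed.

Definition mreg m n (F : (A -> 'M[k]_D) -> 'M[k]_(m, n)) : Prop :=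
  forall i j, reg (fun rho => F rho i j).

Lemma mregC m n (B : 'M[k]_(m, n)) : mreg (fun=> B).
Proof. by move=> i j; exact: regC. Qed.

Lemma mregM m n p (F : (A -> 'M[k]_D) -> 'M[k]_(m, n)) (G : _ -> 'M[k]_(n, p)) :
  mreg F -> mreg G -> mreg (fun rho => F rho *m G rho).
Proof.
move=> hF hG i j.
apply: (@reg_eq (fun rho => \sum_l F rho i l * G rho l j)); first by move=> rho _; rewrite mxE.
by apply: reg_sum => l; exact: regM.
Qed.

Lemma mregB m n (F G : (A -> 'M[k]_D) -> 'M[k]_(m, n)) :
  mreg F -> mreg G -> mreg (fun rho => F rho - G rho).
Proof.
move=> hF hG i j.
apply: (@reg_eq (fun rho => F rho i j + (-1) * G rho i j)).
  by move=> rho _; rewrite !mxE mulN1r.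
by apply: regD => //; apply: regM => //; exact: regC.
Qed.

Lemma mreg_sum m n (I : finType) (F : I -> (A -> 'M[k]_D) -> 'M[k]_(m, n)) :
  (forall i, mreg (F i)) -> mreg (fun rho => \sum_i F i rho).
Proof.
move=> hF i j.
apply: (@reg_eq (fun rho => \sum_l F l rho i j)); first by move=> rho _; rewrite summxE.
by apply: reg_sum => l; exact: hF.
Qed.

Lemma reg_det n (F : (A -> 'M[k]_D) -> 'M[k]_n) : mreg F -> reg (fun rho => \det (F rho)).
Proof.
by move=> hF; apply: reg_sum => s; apply: regM; [exact: regC | apply: reg_prod => i; exact: hF].
Qed.

Lemma near_unit n (F : (A -> 'M[k]_D) -> 'M[k]_n) : mreg F -> F rho0 \in unitmx ->
  near (fun rho => F rho \in unitmx).
Proof.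
move=> hF; rewrite unitmxE unitfE => /(reg_neq0 (reg_det hF)); apply: near_imp => rho _.
by rewrite unitmxE unitfE.
Qed.

Lemma mregV n (F : (A -> 'M[k]_D) -> 'M[k]_n) : mreg F -> F rho0 \in unitmx ->
  mreg (fun rho => invmx (F rho)).
Proof.
move=> hF u0 i j; have d0 : \det (F rho0) != 0 by rewrite -unitfE -unitmxE.
(* Cramer's rule. On singular matrices [invmx] is the identity map, so the formula is only claimed
   near [rho0]. *)
apply: (@reg_near (fun rho => (\det (F rho))^-1 * cofactor (F rho) j i)).
  by apply: near_imp (near_unit hF u0) => rho _ u; rewrite /invmx u !mxE.
apply: regM; first by apply: regV => //; exact: reg_det.
apply: regM; first exact: regC.
apply: reg_det => a b; apply: reg_eq (hF (lift j a) (lift i b)) => rho _.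
by rewrite !mxE.
Qed.

End Germs.

(** * Stably open modules *)

Definition stably_open N : Prop := near (mact N) (fun rho => stab (RMod rho) N).

Lemma orbit_stably_open M : is_mod M -> zariski_open (mod_orbit M) -> stably_open M.
Proof.
move=> mM [F HF].
have [|p [Fp pM]] := proj1 (HF (mact M) mM).
  by exists 1%:M; rewrite unitmx1; split=> // a; rewrite invmx1 mul1mx mulmx1.
exists p; split=> // rho r pr; have [|U [uU eU]] := proj2 (HF rho r); first by exists p.
(* Points of the orbit are isomorphic to [M] itself, so the zero module serves as both projective
   summands. *)
pose O : rmod A := RMod (fun _ : A => 0 : 'M_0).
have mO : is_mod O by split=> [c a b||a b]; apply/matrixP; case.
have pO : projective O.
  move=> X Y g h _ _ _ _ _; exists 0; split; first exact: hom0.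
  by apply/matrixP; case.
exists O, O; split=> //.
have h1 : @hom _ _ (RMod rho) M (invmx U) by move=> a; rewrite /= eU mulmxK.
have h2 : @hom _ _ M (RMod rho) U by move=> a; rewrite /= eU !mulmxA mulmxV // mul1mx.
exists (block_mx (invmx U) 0 0 1%:M), (block_mx U 0 0 1%:M); split.
- by rewrite -[block_mx _ _ _ _]/(col_mx _ _); apply: hom_col_mx;
    apply: (@hom_row_mx _ M O) => //; (exact: hom0 || exact: hom1).
- by rewrite -[block_mx _ _ _ _]/(col_mx _ _); apply: hom_col_mx;
    apply: (@hom_row_mx _ (RMod rho) O) => //; (exact: hom0 || exact: hom1).
- by rewrite mulmx_block !mul0mx !mulmx0 !addr0 add0r mulVmx // mul1mx -scalar_mx_block.
- by rewrite mulmx_block !mul0mx !mulmx0 !addr0 add0r mulmxV // mul1mx -scalar_mx_block.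
Qed.

(* Every homomorphism N -> P extends to the family j(rho) of homomorphisms rho -> P over
   all of the module variety; the cokernel of j(rho) is a family T(rho) near M. *)
Lemma stably_open_syzygy N P M (f : 'M_(mdim N, mdim P)) (g : 'M_(mdim P, mdim M)) :
  ses f g -> projective P -> injective P -> stably_open M -> stably_open N.
Proof.
move=> S pP iP [p [p0 Hp]].
have [R [R1 RF]] := injective_casimir (ses_modm S) iP.
have mN := ses_modl S; have mP := ses_modm S; have mM := ses_modr S.
have [lP oP mulP] := mP.
(* [C] is a linear section of [g], and [r] below is the retraction of [f] that kills [C]. This fixed
   splitting gives coordinates on all nearby cokernels. *)
pose C : 'M_(mdim M, mdim P) := pinvmx g.
have Cg : C *m g = 1%:M by apply: mulVpmx (ses_full S).
have fg := ses_mul0 S.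
have /submxP[r rE] : (1%:M - g *m C <= f)%MS.
  apply: submx_trans (proj2 (andP (ses_exact S))); apply/sub_kermxP.
  by rewrite mulmxBl mul1mx -mulmxA Cg mulmx1 subrr.
have fr : f *m r = 1%:M.
  apply: (row_free_inj (ses_free S)).
  by rewrite -mulmxA -rE mulmxBr mulmx1 mulmxA fg mul0mx subr0 mul1mx.
have Cr : C *m r = 0.
  apply: (row_free_inj (ses_free S)).
  by rewrite -mulmxA -rE mulmxBr mulmx1 mulmxA Cg mul1mx subrr mul0mx.
(* [j] averages [f] with the matrices [R i]. In [q], the factor before [g] projects [P] along the
   image of [j rho] onto the kernel of [r], and [T] is the action induced on the cokernel. *)
pose j (rho : A -> 'M[k]_(mdim N)) : 'M[k]_(mdim N, mdim P) := \sum_i rho (bas i) *m f *m R i.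
pose q (rho : A -> 'M[k]_(mdim N)) : 'M[k]_(mdim P, mdim M) :=
  (1%:M - r *m invmx (j rho *m r) *m j rho) *m g.
pose T (rho : A -> 'M[k]_(mdim N)) (a : A) : 'M[k]_(mdim M) := C *m mact P a *m q rho.
have j0 : j (mact N) = f.
  rewrite /j -[RHS]mulmx1 -R1 mulmx_sumr; apply: eq_bigr => i _.
  by rewrite (ses_homl S) mulmxA.
have q0 : q (mact N) = g.
  by rewrite /q j0 fr invmx1 mulmx1 mulmxBl mul1mx -mulmxA fg mulmx0 subr0.
have T0 a : T (mact N) a = mact M a.
  by rewrite /T q0 -mulmxA (ses_homr S) mulmxA Cg mul1mx.
have regj : mreg (mact N) j.
  apply: mreg_sum => i; apply: mregM; last exact: mregC.
  by apply: mregM; [exact: reg_entry | exact: mregC].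
have regjr : mreg (mact N) (fun rho => j rho *m r) by apply: mregM => //; exact: mregC.
have ujr : j (mact N) *m r \in unitmx by rewrite j0 fr unitmx1.
have regT a : mreg (mact N) (fun rho => T rho a).
  apply: mregM; first exact: mregC.
  apply: mregM; last exact: mregC.
  apply: mregB; first exact: mregC.
  apply: mregM => //; apply: mregM; first exact: mregC.
  exact: mregV.
have n1 : near (mact N) (fun rho => peval (mvcoord (T rho)) p != 0).
  apply: (reg_neq0 mN); first by apply: reg_peval => a i l; exact: regT.
  suff -> : peval (mvcoord (T (mact N))) p = peval (mvcoord (mact M)) p by [].
  (* [T (mact N)] and [mact M] are known to agree pointwise, which suffices for an induction on the
     expression. *)
  elim: (p) => [//|[[i s] c]|p1 IH1 p2 IH2|p1 IH1 p2 IH2] /=; last 2 first.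
  - by rewrite IH1 IH2.
  - by rewrite IH1 IH2.
  - by rewrite T0.
have n2 := near_unit mN regjr ujr.
apply: near_imp (near_and n1 n2) => rho mrho [pT ur].
have [lr or mulr] := mrho.
have hj : @hom _ _ (RMod rho) P (j rho).
  move=> a; rewrite /j -[in RHS](RF _ (fun x => rho x *m f)); last first.
    by move=> c x y; rewrite lr mulmxDl scalemxAl.
  rewrite mulmx_sumr; apply: eq_bigr => i _.
  by rewrite /= mulr !mulmxA.
have jq : j rho *m q rho = 0.
  rewrite /q mulmxA mulmxBr mulmx1.
  have -> : j rho *m (r *m invmx (j rho *m r) *m j rho) =
    (j rho *m r) *m invmx (j rho *m r) *m j rho by rewrite !mulmxA.
  by rewrite mulmxV // mul1mx subrr mul0mx.
have Cq : C *m q rho = 1%:M.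
  by rewrite /q mulmxA mulmxBr mulmx1 !mulmxA Cr !mul0mx subr0.
have fj : row_free (j rho).
  by apply/row_freeP; exists (r *m invmx (j rho *m r)); rewrite mulmxA mulmxV.
have fq : row_full (q rho) by apply/row_fullP; exists C.
have ex : (j rho == kermx (q rho))%MS.
  have jk : (j rho <= kermx (q rho))%MS by apply/sub_kermxP.
  (* Equality follows from the inclusion by comparing dimensions with those of the original exact
     sequence. *)
  rewrite -(geq_leqif (mxrank_leqif_eq jk)) mxrank_ker (eqP fj) (eqP fq).
  by rewrite -[X in (_ <= X)%N](eqP (ses_free S)) (eqmxP (ses_exact S)) mxrank_ker (eqP (ses_full S)).
have hq a : mact P a *m q rho = q rho *m T rho a.
  apply/eqP; rewrite -subr_eq0.
  (* The factor [1 - q rho *m C] lands in the kernel of [q rho], that is, in the image of [j rho],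
     which is stable under [A]. *)
  have -> : mact P a *m q rho - q rho *m T rho a = (1%:M - q rho *m C) *m mact P a *m q rho.
    by rewrite /T !mulmxBl mul1mx !mulmxA.
  have /sub_kermxP : (1%:M - q rho *m C) *m q rho = 0.
    by rewrite mulmxBl mul1mx -mulmxA Cq mulmx1 subrr.
  move=> s; have /submxP[E] := submx_trans s (proj2 (andP ex)) => ->.
  by rewrite -!mulmxA [j rho *m _]mulmxA -hj -!mulmxA jq !mulmx0.
have mT : is_rep (T rho).
  split=> [c a b||a b]; rewrite /T.
  - by rewrite lP mulmxDr mulmxDl -scalemxAr -scalemxAl.
  - by rewrite oP mulmx1.
  - by rewrite mulP mulmxA -[C *m _ *m _ *m q rho]mulmxA hq /T !mulmxA.
have S' : @ses (RMod rho) P (RMod (T rho)) (j rho) (q rho) by split.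
exact: (stab_syzygy S' S pP pP (Hp _ mT pT)).
Qed.

(** * Periodic resolutions *)

Lemma stab_sym X Y : stab X Y -> stab Y X.
Proof. by move=> [P [Q [mP mQ pP pQ [f [g [hf hg fg gf]]]]]]; exists Q, P; split=> //; exists g, f. Qed.

(** The short exact sequences are spliced around a cycle. Indexing by [ordS] makes terms one period
    apart literally equal, as [periodic] demands. *)
Lemma cyclic_syzygies_periodic n (N : 'I_n.+1 -> rmod A) :
  (forall s, exists P (f : 'M_(mdim (N (ordS s)), mdim P)) (g : 'M_(mdim P, mdim (N s))),
    projective P /\ ses f g) ->
  periodic (N ord0).
Proof.
move=> H.
pose P s := proj1_sig (constructive_indefinite_description _ (H s)).
have H1 s : exists f g, projective (P s) /\ @ses (N (ordS s)) (P s) (N s) f g.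
  exact: proj2_sig (constructive_indefinite_description _ (H s)).
pose f s := proj1_sig (constructive_indefinite_description _ (H1 s)).
have H2 s : exists g, projective (P s) /\ @ses (N (ordS s)) (P s) (N s) (f s) g.
  exact: proj2_sig (constructive_indefinite_description _ (H1 s)).
pose g s := proj1_sig (constructive_indefinite_description _ (H2 s)).
have H3 s : projective (P s) /\ @ses (N (ordS s)) (P s) (N s) (f s) (g s).
  exact: proj2_sig (constructive_indefinite_description _ (H2 s)).
have S s := (H3 s).2.
pose D s : 'M_(mdim (P (ordS s)), mdim (P s)) := g (ordS s) *m f s.
pose st t := iter t (@ordS n.+1) ord0.
have DK s : (D s == kermx (g s))%MS.
  apply/eqmxP; apply: eqmx_trans (eqmxP (ses_exact (S s))).
  exact: eqmxMfull (ses_full _).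
have KD s : (kermx (D s) == kermx (g (ordS s)))%MS.
  apply/andP; split; apply/sub_kermxP; last by rewrite mulmxA mulmx_ker mul0mx.
  by apply: (row_free_inj (ses_free (S s))); rewrite mul0mx -mulmxA mulmx_ker.
exists (fun t => P (st t)), (fun t => D (st t)), (g ord0); split.
  split; first by move=> t; exact: ses_modm (S _).
  split; first by move=> t; exact: (H3 _).1.
  split; first by split; [exact: ses_homr (S _) | exact: ses_full (S _)].
  split; first by move=> t; apply: homM (ses_homr (S _)) (ses_homl (S _)).
  split; first exact: DK.
  by move=> t; apply/eqmxP/(eqmx_trans (eqmxP (DK _)))/eqmx_sym/eqmxP; exact: KD.
exists n.+1; split=> // t.
have stE u : val (st u) = (u %% n.+1)%N.
  by elim: u => [|u IH]; rewrite ?mod0n //= IH -addn1 modnDml addn1.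
(* The types of [D s] and [D s'] differ until the indices are identified, so the equality is proved
   for arbitrary equal indices. *)
have G s s' : s = s' -> P s = P s' /\ forall i j, mxnat (D s) i j = mxnat (D s') i j.
  by move=> ->.
by apply: G; apply: val_inj; rewrite !stE modnDr.
Qed.

End ModuleAlgebra.

(** * Recurring dimensions and the closing of the resolution *)

Lemma bounded_recurrent (B : nat) (f : nat -> nat) (m0 : nat) :
  (forall n, m0 <= n -> f n <= B) -> exists D, forall m, exists2 n, m <= n & f n = D.
Proof.
elim: B m0 => [|B IH] m0 fB.
  exists 0 => m; exists (maxn m m0); first exact: leq_maxl.
  by apply/eqP; rewrite -leqn0; apply: fB; exact: leq_maxr.
(* Either the value [B.+1] recurs forever, or beyond some point the bound drops to [B]. *)
have [H|H] := classic (forall m, exists2 n, m <= n & f n = B.+1); first by exists B.+1.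
have [m1 Hm1] := not_all_ex_not _ _ H.
apply: (IH (maxn m0 m1)) => n; rewrite geq_max => /andP[n0 n1].
have := fB n n0; rewrite leq_eqVlt => /orP[/eqP e|//].
by case: Hm1; exists n.
Qed.

Lemma complexity1_recurrent (k : fieldType) (A : falgType k) (M : rmod A) :
  is_mod M -> complexity M 1 ->
  exists P (N : nat -> rmod A), [/\ N 0 = M, forall t, projective (P t),
    forall t, exists f g, @ses k A (N t.+1) (P t) (N t) f g &
    exists D, forall m, exists2 n, m <= n & mdim (N n) = D].
Proof.
move=> mM [P [d [e [[res _] [[C [C0 HC]] _]]]]].
have [N N0 S] := syzygies mM res; exists P, N; split=> //; first by case: res => _ [].
(* Growth of order 1 bounds [P t] by the constant [C] for positive [t], and [N t.+1] embeds in
   [P t]; hence the bound starts at index 2. *)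
apply: (@bounded_recurrent (Num.bound C) _ 2) => -[|[|t]] // _.
have [f [g /ses_free fr]] := S t.+1.
have le1 : mdim (N t.+2) <= mdim (P t.+1) by have := rank_leq_col f; rewrite (eqP fr).
have := HC t.+1 isT; rewrite subrr expr0z mulr1 => le2.
apply: leq_trans le1 _; rewrite -(ler_nat rat).
apply: le_trans le2 _; apply: ltW.
exact/archi_boundP/ltW.
Qed.

Theorem theorem1 (k : closedFieldType) (A : falgType k) (M : rmod A) :
  basic A -> self_injective A -> is_mod M ->
  complexity M 1 -> zariski_open (mod_orbit M) -> periodic M.
Proof.
move=> _ AI mM cx op.
have PI (Q : rmod A) : is_mod Q -> projective Q -> injective Q by exact: projective_injective.
have [P [N [N0 pP S [D HD]]]] := complexity1_recurrent mM cx.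
have mP t : is_mod (P t) by have [f [g /ses_modm]] := S t.
have mN t : is_mod (N t) by have [f [g /ses_modr]] := S t.
have opN t : stably_open (N t).
  elim: t => [|t IH]; first by rewrite N0; exact: orbit_stably_open.
  by have [f [g s]] := S t; apply: (stably_open_syzygy s) => //; exact: PI.
have HD' m : exists n, m < n /\ exists rho : A -> 'M[k]_D, N n = RMod rho.
  have [n lt e] := HD m.+1; exists n; split=> //.
  by move: e; case: (N n) => D' rho /= <-; exists rho.
pose nxt m := epsilon (inhabits 0) (fun n => m < n /\ exists rho : A -> 'M[k]_D, N n = RMod rho).
have nxtP m := epsilon_spec (inhabits 0) _ (HD' m).
(* At least one iteration is made, so that every [s n] is a value of [nxt] and its syzygy has
   dimension [D]. *)
pose s n := iter n.+1 nxt 0.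
have sS n : s n < s n.+1 by case: (nxtP (s n)).
have sN n : exists rho : A -> 'M[k]_D, N (s n) = RMod rho by case: (nxtP (iter n nxt 0)).
pose y n := proj1_sig (constructive_indefinite_description _ (sN n)).
have yN n : N (s n) = RMod (y n) := proj2_sig (constructive_indefinite_description _ (sN n)).
have Hu n : near (y n) (fun rho => stab (RMod rho) (N (s n))).
  by have := opN (s n); rewrite yN.
pose u n := proj1_sig (constructive_indefinite_description _ (Hu n)).
have uP n := proj2_sig (constructive_indefinite_description _ (Hu n)).
have [i [j [ltij ne]]] := @noetherian_points k ('I_(\dim (fullv : {vspace A})) * 'I_D * 'I_D)%type
  (fun n => mvcoord (y n)) u (fun n => proj1 (uP n)).
have ltsij : s i < s j by exact: (homo_ltn ltn_trans sS).
have st : stab (N (s j)) (N (s i)).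
  by have := mN (s j); rewrite (yN j) => mj; exact: (proj2 (uP i)) mj ne.
(* Taking cosyzygies [a] times moves the stable isomorphism back to the start of the resolution. *)
have desc a b : stab (N (a + b)) (N a) -> stab (N b) (N 0).
  elim: a => [//|a IH]; rewrite addSn => H; apply: IH.
  have [f [g s1]] := S (a + b); have [f' [g' s2]] := S a.
  exact: (stab_cosyzygy PI s1 s2).
rewrite -(subnKC (ltnW ltsij)) in st.
have := desc _ _ st; case: (s j - s i) (subn_gt0 (s i) (s j)) => [|n _ stn]; first by rewrite ltsij.
(* The period is [n.+1 = s j - s i]. The sequences before index [n] are kept; in the last one the
   left end [N n.+1] is replaced by the stably isomorphic [N 0]. *)
rewrite -N0; apply: (@cyclic_syzygies_periodic _ _ n (fun t => N t)) => t.
have [f [g St]] := S t; have [ltn|len] := ltnP t n.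
  by rewrite /= modn_small // ; exists (P t), f, g.
have tn : val t = n by apply/eqP; rewrite eqn_leq len -ltnS ltn_ord.
rewrite /= tn modnn; move: f g St; rewrite /= tn => f g St.
by apply: (ses_stab PI St (pP n)); [rewrite N0 | exact: stab_sym].
Qed.
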